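(* Let $H=\begin{bmatrix}H_{11}&H_{12}\\H_{12}^\top&H_{22}\end{bmatrix}\in\mathbb{R}^{d\times d}$ be symmetric positive semidefinite, with $H_{ij}\in\mathbb{R}^{d_i\times d_j}$, $d=d_1+d_2$, and suppose $H_{11}\succ0$ and $H_{22}\succ0$. Let $$M_1=\begin{bmatrix}H_{11}&0\\H_{12}^\top&H_{22}\end{bmatrix}^{-1}\begin{bmatrix}0&-H_{12}\\0&0\end{bmatrix},\qquad M_2=\begin{bmatrix}H_{11}&H_{12}\\0&H_{22}\end{bmatrix}^{-1}\begin{bmatrix}0&0\\-H_{12}^\top&0\end{bmatrix},$$ and $M_3=(M_1+M_2)/2$. Then $$\rho(M_1)=\rho(M_2)\le\rho(M_3).$$
   Context: $\rho(\cdot)$ denotes the spectral radius and $\succ0$ means positive definite. ($M_1$ and $M_2$ are the iteration matrices of 2-block cyclic BCD, with the two possible block orders, for minimizing $\frac12x^\top Hx+g^\top x$, and $M_3$ is the expected iteration matrix of 2-block randomly permuted BCD.) *)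

(* Defs.v *)
From HB Require Import structures.
From mathcomp Require Import all_boot all_order all_algebra.
From mathcomp Require Import complex.
From mathcomp Require Import classical_sets reals.

Set Implicit Arguments.
Unset Strict Implicit.
Unset Printing Implicit Defensive.

Import Order.TTheory GRing.Theory Num.Theory.
Local Open Scope classical_set_scope.
Local Open Scope ring_scope.

Definition psdmx (R : realType) (n : nat) (A : 'M[R]_n) : Prop :=
  A^T = A /\ forall x : 'cV[R]_n, 0 <= (x^T *m A *m x) 0 0.

Definition pdmx (R : realType) (n : nat) (A : 'M[R]_n) : Prop :=
  A^T = A /\ forall x : 'cV[R]_n, x != 0 -> 0 < (x^T *m A *m x) 0 0.

(* The eigenvalues of a real matrix are taken in the complex numbers R[i].
   The set is finite, so for n > 0 the supremum is a maximum; for n = 0 the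
   set is empty and the value is sup set0 = 0. *)
Definition spectral_radius (R : realType) (n : nat) (A : 'M[R]_n) : R :=
  sup [set Normc.normc z |
        z in [set z : R[i] | eigenvalue (map_mx (real_complex R) A) z]].

(* Main.v *)
Require Import Defs.
From HB Require Import structures.
From mathcomp Require Import all_boot all_order all_algebra.
From mathcomp Require Import complex.
From mathcomp Require Import boolp classical_sets reals.

(** With P = H11^-1 H12 and Q = H22^-1 H12^T the iteration matrices are
<<
   M1 = [ 0  -P ]     M2 = [ PQ  0 ]     M1 + M2 = [ PQ  -P ]
        [ 0  QP ]          [ -Q  0 ]               [ -Q  QP ]
>>
    so the nonzero eigenvalues of M1 are those of QP and the nonzero
    eigenvalues of M2 are those of PQ.  Since PQ and QP have the same nonzero
    eigenvalues, M1 and M2 have the same spectral radius.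

    Let u (QP) = z u with z nonzero.  On the plane spanned by the row vectors
    (uQ, 0) and (0, u) the matrix M1 + M2 acts through a 2 x 2 matrix with
    eigenvalues z + r and z - r, where r ^ 2 = z; hence (z + r) / 2 is an
    eigenvalue of M3 ([eigenvalue_sweep_avg]).  This number dominates z as soon
    as z lies in [0, 1] and r is its nonnegative root, because then z <= r.

    That z lies in [0, 1] is where the positivity of H enters
    ([pencil_eigenvalue_itv]).  Put K = H12^T H11^-1 H12, so QP = H22^-1 K.  An
    eigenvector of QP yields a complex row vector w with w K w^* = z w H22 w^*.
    Both K and the Schur complement H22 - K are positive semidefinite, hence
    0 <= w K w^* <= w H22 w^*, and w H22 w^* > 0.

    The eigenvalue 0 never has to be matched: a spectral radius is nonnegative,
    so comparing moduli of nonzero eigenvalues suffices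
    ([spectral_radius_le]). *)

Set Implicit Arguments.
Unset Strict Implicit.
Unset Printing Implicit Defensive.

Import Order.TTheory GRing.Theory Num.Theory.
Local Open Scope ring_scope.

(** * Eigenvalues of the two sweeps and of their average *)

Section SweepEigenvalues.
Variables (F : fieldType) (d1 d2 : nat).
Implicit Types (P : 'M[F]_(d1, d2)) (Q : 'M[F]_(d2, d1)) (z : F).

Definition sweep12 P Q : 'M[F]_(d1 + d2) := block_mx 0 (- P) 0 (Q *m P).
Definition sweep21 P Q : 'M[F]_(d1 + d2) := block_mx (P *m Q) 0 (- Q) 0.

(** The zero block column forces the first component of a left eigenvector
    with nonzero eigenvalue to vanish. *)
Lemma eigenvalue_sweep12 P Q z : z != 0 ->
  eigenvalue (sweep12 P Q) z = eigenvalue (Q *m P) z.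
Proof.
move=> z0; apply/eigenvalueP/eigenvalueP => -[v Ev vn0].
- move: Ev vn0; rewrite -[v]hsubmxK mul_row_block !mulmx0 addr0 scale_row_mx.
  move=> /eq_row_mx[/esym/eqP]; rewrite scaler_eq0 (negPf z0) /= => /eqP ->.
  rewrite mul0mx add0r => E; rewrite row_mx_eq0 eqxx /= => n0.
  by exists (rsubmx v).
- exists (row_mx 0 v); last by rewrite row_mx_eq0 eqxx.
  by rewrite mul_row_block !(mulmx0, mul0mx) addr0 add0r Ev scale_row_mx scaler0.
Qed.

Lemma eigenvalue_sweep21 P Q z : z != 0 ->
  eigenvalue (sweep21 P Q) z = eigenvalue (P *m Q) z.
Proof.
move=> z0; apply/eigenvalueP/eigenvalueP => -[v Ev vn0].
- move: Ev vn0; rewrite -[v]hsubmxK mul_row_block !mulmx0 addr0 scale_row_mx.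
  move=> /eq_row_mx[E /esym/eqP]; rewrite scaler_eq0 (negPf z0) /= => /eqP r0.
  move: E; rewrite r0 mul0mx addr0 => E; rewrite row_mx_eq0 eqxx andbT => n0.
  by exists (lsubmx v).
- exists (row_mx v 0); last by rewrite row_mx_eq0 eqxx andbT.
  by rewrite mul_row_block !(mulmx0, mul0mx) !addr0 Ev scale_row_mx scaler0.
Qed.

(** If [u] is a left eigenvector of [Q *m P] for [z = r ^+ 2], the sum of the
    two sweeps maps [(a uQ, b u)] to [((z a - b) uQ, (z b - z a) u)].  The
    vector [(a, b) = (1, - r)] is an eigenvector of this 2 x 2 system for
    [z + r]. *)
Lemma eigenvalue_sweep_avg P Q r : r != 0 -> eigenvalue (Q *m P) (r ^+ 2) ->
  eigenvalue (2^-1 *: (sweep12 P Q + sweep21 P Q)) (2^-1 * (r ^+ 2 + r)).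
Proof.
move=> r0 /eigenvalueP[u Eu un0].
have EP : u *m Q *m P = r ^+ 2 *: u by rewrite -mulmxA.
apply/eigenvalueP; exists (row_mx (u *m Q) (- r *: u)); last first.
  by rewrite row_mx_eq0 negb_and scaler_eq0 oppr_eq0 (negPf r0) un0 orbT.
rewrite -scalemxAr -scalerA; congr (_ *: _).
rewrite add_block_mx !add0r !addr0 mul_row_block scale_row_mx.
rewrite mulmxN -!scalemxAl !(mulmxA, mulmxN) EP -!scalemxAl; congr row_mx.
  by rewrite scaleNr opprK -scalerDl.
rewrite -scaleNr !scalerA -scalerDl; congr (_ *: _).
by rewrite mulrDl !mulrN !mulNr -expr2 mulrC addrC.
Qed.

End SweepEigenvalues.

(** A left eigenvector [v] of [A *m B] is carried to the left eigenvector
    [v *m A] of [B *m A], which is nonzero because [z] is. *)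
Lemma eigenvalue_mulC (F : fieldType) m n (A : 'M[F]_(m, n)) (B : 'M_(n, m)) z :
  z != 0 -> eigenvalue (A *m B) z -> eigenvalue (B *m A) z.
Proof.
move=> z0 /eigenvalueP[v Ev vn0]; apply/eigenvalueP; exists (v *m A).
  by rewrite mulmxA -(mulmxA v) Ev scalemxAl.
apply: contraNneq vn0 => vA0; have := Ev.
by rewrite mulmxA vA0 mul0mx => /esym/eqP; rewrite scaler_eq0 (negPf z0).
Qed.

Section BlockTriangularSystems.
Variables (F : fieldType) (d1 d2 : nat).
Variables (H11 : 'M[F]_d1) (H12 : 'M[F]_(d1, d2)) (H22 : 'M[F]_d2).
Hypotheses (u11 : H11 \in unitmx) (u22 : H22 \in unitmx).
Local Notation P := (invmx H11 *m H12).
Local Notation Q := (invmx H22 *m H12^T).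

Lemma sweep12E :
  invmx (block_mx H11 0 H12^T H22) *m block_mx 0 (- H12) 0 0 = sweep12 P Q.
Proof.
have uL : block_mx H11 0 H12^T H22 \in unitmx.
  by rewrite unitmxE det_lblock unitrM -!unitmxE u11.
rewrite -[RHS](mulKmx uL); congr (_ *m _).
rewrite mulmx_block !(mulmx0, mul0mx, addr0, mulmxN).
by rewrite !mulKVmx // -!mulmxA mulKVmx // addNr.
Qed.

Lemma sweep21E :
  invmx (block_mx H11 H12 0 H22) *m block_mx 0 0 (- H12^T) 0 = sweep21 P Q.
Proof.
have uU : block_mx H11 H12 0 H22 \in unitmx.
  by rewrite unitmxE det_ublock unitrM -!unitmxE u11.
rewrite -[RHS](mulKmx uU); congr (_ *m _).
rewrite mulmx_block !(mulmx0, mul0mx, addr0, add0r, mulmxN).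
by rewrite mulKVmx // -!mulmxA mulKVmx // subrr.
Qed.

End BlockTriangularSystems.

Section RealMatrices.
Variable R : realType.
Local Notation C := R[i].
Local Notation "A ^@" := (map_mx (real_complex R) A)
  (at level 2, format "A ^@").

Lemma map_sweep12 d1 d2 (P : 'M[R]_(d1, d2)) (Q : 'M[R]_(d2, d1)) :
  (sweep12 P Q)^@ = sweep12 P^@ Q^@.
Proof. by rewrite /sweep12 map_block_mx !map_mx0 map_mxN map_mxM. Qed.

Lemma map_sweep21 d1 d2 (P : 'M[R]_(d1, d2)) (Q : 'M[R]_(d2, d1)) :
  (sweep21 P Q)^@ = sweep21 P^@ Q^@.
Proof. by rewrite /sweep21 map_block_mx !map_mx0 map_mxN map_mxM. Qed.

(** * Positivity of real symmetric forms on complex vectors *)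

(** Writing [w = x + i y], the cross terms [i (y S x^T - x S y^T)] cancel by
    the symmetry of [S]. *)
Lemma complex_form n (S : 'M[R]_n) (w : 'rV[C]_n) : S^T = S ->
  let x := map_mx (@complex.Re R) w in let y := map_mx (@complex.Im R) w in
  (w *m S^@ *m (map_mx conjc w)^T) 0 0
    = ((x *m S *m x^T) 0 0 + (y *m S *m y^T) 0 0)%:C%C.
Proof.
move=> symS x y.
have Ew : w = x^@ + 'i%C *: y^@.
  by apply/matrixP => i j; rewrite !mxE -complexE.
have Ewc : map_mx conjc w = x^@ - 'i%C *: y^@.
  apply/matrixP => i j; rewrite !mxE; case: (w i j) => a b /=; by simpc.
clearbody x y.
rewrite Ewc {1}Ew linearB linearZ /= !mulmxDl !mulmxBr -!scalemxAl -!scalemxAr.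
rewrite !map_trmx -!map_mxM.
have -> : y *m S *m x^T = x *m S *m y^T.
  rewrite [RHS]mx11_scalar -tr_scalar_mx -mx11_scalar.
  by rewrite !trmx_mul trmxK symS mulmxA.
rewrite !scalerA -expr2 sqr_i scaleN1r opprK addrA subrK.
by rewrite -map_mxD !mxE.
Qed.

Lemma psd_form_ge0 n (S : 'M[R]_n) (w : 'rV[C]_n) : psdmx S ->
  0 <= (w *m S^@ *m (map_mx conjc w)^T) 0 0.
Proof.
case=> symS psdS; rewrite complex_form // ler0c.
by apply: addr_ge0; rewrite -[X in X *m S *m _]trmxK psdS.
Qed.

Lemma pd_psd n (S : 'M[R]_n) : pdmx S -> psdmx S.
Proof.
case=> symS pdS; split=> // x; have [->|/pdS/ltW //] := eqVneq x 0.
by rewrite mulmx0 mxE.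
Qed.

Lemma pd_form_gt0 n (S : 'M[R]_n) (w : 'rV[C]_n) : pdmx S -> w != 0 ->
  0 < (w *m S^@ *m (map_mx conjc w)^T) 0 0.
Proof.
move=> pdS w0; have [symS psdS] := pd_psd pdS; have [_ posS] := pdS.
set x := map_mx (@complex.Re R) w; set y := map_mx (@complex.Im R) w.
have form_ge0 (u : 'rV_n) : 0 <= (u *m S *m u^T) 0 0.
  by have := psdS u^T; rewrite trmxK.
have form_gt0 (u : 'rV_n) : u != 0 -> 0 < (u *m S *m u^T) 0 0.
  by move=> u0; have := posS u^T; rewrite trmx_eq0 trmxK => ->.
rewrite complex_form // -/x -/y ltcR.
have [x0|xn0] := eqVneq x 0; last by rewrite ltr_pwDl // form_gt0.
have [y0|yn0] := eqVneq y 0; last by rewrite ltr_wpDl // form_gt0.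
case/negP: w0; apply/eqP/matrixP => i j; rewrite [LHS]complexE mxE.
have := congr1 (fun u : 'rV_n => u i j) x0; rewrite !mxE => ->.
have := congr1 (fun u : 'rV_n => u i j) y0; rewrite !mxE => ->.
by rewrite mulr0 addr0.
Qed.

Lemma pdmx_unit n (S : 'M[R]_n) : pdmx S -> S \in unitmx.
Proof.
case=> _ posS; rewrite -row_free_unit -kermx_eq0; apply/rowV0P => v.
move/sub_kermxP => vS0; apply/eqP; apply/negP => /negP v0.
have : v^T != 0 by rewrite trmx_eq0.
by move/posS; rewrite trmxK vS0 mul0mx mxE ltxx.
Qed.

(** Evaluate the form of the block matrix at [(- H11^-1 H12 x, x)], the
    minimizer over the first block with the second block [x] held fixed. *)
Lemma schur_psd d1 d2 (H11 : 'M[R]_d1) (H12 : 'M[R]_(d1, d2)) (H22 : 'M[R]_d2) :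
  psdmx (block_mx H11 H12 H12^T H22) -> pdmx H11 -> pdmx H22 ->
  psdmx (H22 - H12^T *m invmx H11 *m H12).
Proof.
move=> [_ psdH] pd11 [sym22 _]; have [sym11 _] := pd11.
have u11 := pdmx_unit pd11; split.
  by rewrite linearB /= !trmx_mul trmxK trmx_inv sym11 sym22 mulmxA.
move=> x; have := psdH (col_mx (- (invmx H11 *m H12 *m x)) x).
rewrite tr_col_mx mul_row_block mul_row_col.
suff -> : (- (invmx H11 *m H12 *m x))^T *m H11 + x^T *m H12^T = 0.
  rewrite mul0mx add0r; congr (0 <= (_ *m x) 0 0).
  rewrite mulmxBr addrC linearN /= !trmx_mul trmx_inv sym11 mulNmx.
  by rewrite !mulmxA.
rewrite linearN /= !trmx_mul trmx_inv sym11 mulNmx -!mulmxA mulVmx //.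
by rewrite mulmx1 addNr.
Qed.

Lemma congr_invmx_psd d1 d2 (H11 : 'M[R]_d1) (H12 : 'M[R]_(d1, d2)) :
  pdmx H11 -> psdmx (H12^T *m invmx H11 *m H12).
Proof.
move=> pd11; have [sym11 psd11] := pd_psd pd11; split.
  by rewrite !trmx_mul trmxK trmx_inv sym11 mulmxA.
move=> x; have := psd11 (invmx H11 *m H12 *m x).
by rewrite !trmx_mul trmx_inv sym11 -!mulmxA mulKVmx // pdmx_unit.
Qed.

(** The eigenvalue is the quotient of the forms of [K] and [S] at a common
    complex vector.  In the order of [C], [0 <= z] also says that [z] is
    real. *)
Lemma pencil_eigenvalue_itv n (K S : 'M[R]_n) (z : C) :
  psdmx K -> pdmx S -> psdmx (S - K) -> eigenvalue (invmx S *m K)^@ z ->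
  0 <= z <= 1.
Proof.
move=> psdK pdS psdSK /eigenvalueP[u Eu un0].
pose w := u *m (invmx S)^@.
have wS : w *m S^@ = u.
  by rewrite -mulmxA -map_mxM mulVmx ?map_mx1 ?mulmx1 // pdmx_unit.
have wn0 : w != 0.
  by apply: contraNneq un0 => w0; rewrite -wS w0 mul0mx.
have wK : w *m K^@ = z *: (w *m S^@) by rewrite wS -Eu map_mxM mulmxA.
pose form (A : 'M[R]_n) := (w *m A^@ *m (map_mx conjc w)^T) 0 0.
have formK : form K = z * form S by rewrite /form wK -scalemxAl [LHS]mxE.
have formSK : form (S - K) = (1 - z) * form S.
  rewrite mulrBl mul1r -formK /form map_mxB mulmxBr mulmxBl mxE.
  by rewrite [X in _ + X]mxE.
have S_gt0 : 0 < form S := pd_form_gt0 pdS wn0.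
have : 0 <= form K := psd_form_ge0 w psdK.
have : 0 <= form (S - K) := psd_form_ge0 w psdSK.
by rewrite formK formSK !pmulr_lge0 // subr_ge0 => -> ->.
Qed.

Lemma sqr_le_avg_root (r : C) : 0 <= r -> r ^+ 2 <= 1 ->
  r ^+ 2 <= 2^-1 * (r ^+ 2 + r).
Proof.
move=> r_ge0; rewrite expr_le1 // => r_le1.
rewrite mulrC ler_pdivlMr ?ltr0n // mulr_natr mulr2n lerD2l.
by rewrite expr2 ler_piMl.
Qed.

(** * Comparison of spectral radii *)

Lemma normc_le (z w : C) : (Normc.normc z <= Normc.normc w) = (`|z| <= `|w|).
Proof. by rewrite -lecR. Qed.

Lemma normc_ge0 (z : C) : 0 <= Normc.normc z.
Proof. by rewrite -ler0c; exact: normr_ge0 z. Qed.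

(** Each eigenvalue is one of the finitely many roots of the characteristic
    polynomial, so its modulus is at most the sum of all their moduli. *)
Lemma spectrum_bounded n (A : 'M[R]_n) :
  exists b, forall z, eigenvalue A^@ z -> Normc.normc z <= b.
Proof.
have [rs Ers] := closed_field_poly_normal (char_poly A^@).
exists (\sum_(w <- rs) Normc.normc w) => z; rewrite eigenvalue_root_char Ers.
rewrite rootZ; last by rewrite (monicP (char_poly_monic _)) oner_eq0.
rewrite root_prod_XsubC => zrs; rewrite (big_rem z) //= lerDl.
by apply: sumr_ge0 => w _; apply: normc_ge0.
Qed.

Lemma eigenvalue_le_spectral_radius n (A : 'M[R]_n) z :
  eigenvalue A^@ z -> Normc.normc z <= spectral_radius A.
Proof.
move=> Az; have [b ltb] := spectrum_bounded A.
apply: ub_le_sup; last by exists z.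
by exists b => x [w Aw <-]; apply: ltb.
Qed.

Lemma spectral_radius_no_eigenvalue n (A : 'M[R]_n) :
  ~ (exists z, eigenvalue A^@ z) -> spectral_radius A = 0.
Proof.
move=> noz; rewrite /spectral_radius.
set E := (X in sup X); suff -> : E = set0 by rewrite sup0.
by rewrite -subset0 => x [z Az _]; case: noz; exists z.
Qed.

Lemma spectral_radius_ge0 n (A : 'M[R]_n) : 0 <= spectral_radius A.
Proof.
have [[z Az]|noz] := pselect (exists z, eigenvalue A^@ z).
  exact: le_trans (normc_ge0 z) (eigenvalue_le_spectral_radius Az).
by rewrite spectral_radius_no_eigenvalue.
Qed.

(** The eigenvalue 0 of [A] needs no counterpart in [B], because the spectral
    radius of [B] is nonnegative even when its spectrum is empty. *)
Lemma spectral_radius_le m n (A : 'M[R]_m) (B : 'M[R]_n) :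
  (forall z, z != 0 -> eigenvalue A^@ z ->
     exists2 w, eigenvalue B^@ w & `|z| <= `|w|) ->
  spectral_radius A <= spectral_radius B.
Proof.
move=> dom.
have [[z Az]|noz] := pselect (exists z, eigenvalue A^@ z); last first.
  by rewrite (spectral_radius_no_eigenvalue noz) spectral_radius_ge0.
apply: ge_sup; first by exists (Normc.normc z), z.
move=> x [t At <-]; have [->|tn0] := eqVneq t 0.
  by rewrite Normc.normc0 spectral_radius_ge0.
have [w Bw] := dom t tn0 At; rewrite -normc_le => /le_trans; apply.
exact: eigenvalue_le_spectral_radius.
Qed.

Lemma spectral_radius_sweeps d1 d2 (P : 'M[R]_(d1, d2)) (Q : 'M[R]_(d2, d1)) :
  spectral_radius (sweep12 P Q) = spectral_radius (sweep21 P Q).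
Proof.
apply/eqP; rewrite eq_le; apply/andP; split; apply: spectral_radius_le => z z0.
- rewrite map_sweep12 map_sweep21 eigenvalue_sweep12 // => /(eigenvalue_mulC z0).
  by exists z; rewrite ?eigenvalue_sweep21.
- rewrite map_sweep12 map_sweep21 eigenvalue_sweep21 // => /(eigenvalue_mulC z0).
  by exists z; rewrite ?eigenvalue_sweep12.
Qed.

(** Each nonzero eigenvalue [z] of [Q *m P] is matched with the eigenvalue
    [(z + sqrtC z) / 2] of the average, which is at least [z] because
    [z <= sqrtC z] on the unit interval. *)
Lemma spectral_radius_sweep_avg d1 d2 (P : 'M[R]_(d1, d2)) (Q : 'M[R]_(d2, d1)) :
  (forall z, eigenvalue (Q *m P)^@ z -> 0 <= z <= 1) ->
  spectral_radius (sweep21 P Q)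
    <= spectral_radius (2^-1 *: (sweep12 P Q + sweep21 P Q)).
Proof.
move=> QP_itv; apply: spectral_radius_le => z z0.
rewrite map_sweep21 eigenvalue_sweep21 // => /(eigenvalue_mulC z0) Ez.
have /andP[z_ge0 z_le1] : 0 <= z <= 1 by apply: QP_itv; rewrite map_mxM.
have sqr_z : sqrtC z ^+ 2 = z by rewrite sqrtCK.
exists (2^-1 * (sqrtC z ^+ 2 + sqrtC z)).
  rewrite map_mxZ map_mxD map_sweep12 map_sweep21 fmorphV rmorph_nat.
  by apply: eigenvalue_sweep_avg; rewrite ?sqrtC_eq0 ?sqr_z.
have r_ge0 : 0 <= sqrtC z by rewrite sqrtC_ge0.
have le_z : z <= 2^-1 * (sqrtC z ^+ 2 + sqrtC z).
  by rewrite -{1}sqr_z sqr_le_avg_root ?sqr_z.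
by rewrite !ger0_norm // (le_trans z_ge0).
Qed.

End RealMatrices.

Theorem proposition2 (R : realType) (d1 d2 : nat)
    (H11 : 'M[R]_d1) (H12 : 'M[R]_(d1, d2)) (H22 : 'M[R]_d2)
    (H_psd : psdmx (block_mx H11 H12 H12^T H22))
    (H11_pd : pdmx H11) (H22_pd : pdmx H22) :
  let M1 := invmx (block_mx H11 0 H12^T H22) *m block_mx 0 (- H12) 0 0 in
  let M2 := invmx (block_mx H11 H12 0 H22) *m block_mx 0 0 (- H12^T) 0 in
  let M3 := 2^-1 *: (M1 + M2) in
  spectral_radius M1 = spectral_radius M2 /\
  spectral_radius M2 <= spectral_radius M3.
Proof.
have u11 := pdmx_unit H11_pd; have u22 := pdmx_unit H22_pd.
move=> M1 M2 M3; rewrite /M3 /M1 /M2 (sweep12E _ u11 u22) (sweep21E _ u11 u22).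
split.
  exact: spectral_radius_sweeps.
apply: spectral_radius_sweep_avg => z.
rewrite -mulmxA (mulmxA H12^T) => Ez.
exact: (pencil_eigenvalue_itv (congr_invmx_psd H12 H11_pd) H22_pd
          (schur_psd H_psd H11_pd H22_pd) Ez).
Qed.
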